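(* Let $\Pi$ be a derivation in system STI of $\Gamma \vdash M : \sigma$, and suppose $M$ $\beta$-reduces to $M'$ in $n$ steps, i.e. $M \to_\beta M_1 \to_\beta \cdots \to_\beta M_n = M'$. Then: (i) $n < |M|^{D(\Pi)+1}$; (ii) $|M'| < |M|^{D(\Pi)+1}$.
   Context: Terms of the $\lambda$-calculus: $M ::= x \mid MM \mid \lambda x.M$, considered modulo renaming of bound variables; $M[N/x]$ is capture-free substitution of $N$ for the free occurrences of $x$; $\to_\beta$ is the contextual closure of $(\lambda x.M)N \to M[N/x]$. Size of a term: $|x|=1$, $|\lambda x.M| = |M|+1$, $|MN| = |M|+|N|+1$. Types of STI: linear types $A ::= a \mid \sigma \to A$ ($a$ ranging over a countable set of type variables) and intersection types $\sigma ::= A \mid \sigma_1 \wedge \cdots \wedge \sigma_n$ ($n>1$), where the $n$-ary connective $\wedge$ is commutative but neither idempotent nor associative. A context is a finite set of assumptions $x:\sigma$ with pairwise distinct variables; $\mathrm{dom}(\Gamma)$ is its set of variables; $\Gamma \# \Delta$ means $\mathrm{dom}(\Gamma)\cap\mathrm{dom}(\Delta)=\emptyset$, and then $\Gamma,\Delta$ is their union. The intersection $\Gamma\wedge\Delta$ consists of $x:\sigma$ for $x:\sigma\in\Gamma$, $x\notin\mathrm{dom}(\Delta)$; $x:\tau$ for $x:\tau\in\Delta$, $x\notin\mathrm{dom}(\Gamma)$; and $x:\sigma\wedge\tau$ for $x:\sigma\in\Gamma$, $x:\tau\in\Delta$; $\bigwedge_{i=1}^n\Gamma_i$ is the intersection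 of $\Gamma_1,\dots,\Gamma_n$ formed in the same way. Rules of STI (judgements $\Gamma\vdash M:\sigma$): (Ax) $x:A \vdash x:A$. (w) from $\Gamma\vdash M:\sigma$ and $x\notin\mathrm{dom}(\Gamma)$ infer $\Gamma, x:A\vdash M:\sigma$. ($\to$I) from $\Gamma, x:\sigma\vdash M:A$ infer $\Gamma\vdash\lambda x.M:\sigma\to A$. ($\to$E) from $\Gamma\vdash M:\sigma\to A$ and $\Delta\vdash N:\sigma$ with $\Gamma\#\Delta$ infer $\Gamma,\Delta\vdash MN:A$. ($\wedge_n$) for $n>1$, from $\Gamma_i\vdash M:\sigma_i$ ($1\le i\le n$) infer $\bigwedge_{i=1}^n\Gamma_i\vdash M:\sigma_1\wedge\cdots\wedge\sigma_n$. (m) from $\Gamma, x_1:\sigma_1,\dots,x_n:\sigma_n\vdash M:\tau$ infer $\Gamma, x:\sigma_1\wedge\cdots\wedge\sigma_n\vdash M[x/x_1,\dots,x/x_n]:\tau$. The degree $D(\Pi)$ of a derivation $\Pi$ is the maximal number of applications of ($\wedge_n$) rules on a path from the conclusion of $\Pi$ to an axiom of $\Pi$. *)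

(* Defs.v *)
From HB Require Import structures.
From mathcomp Require Import all_boot.
From mathcomp Require Import generic_quotient finmap boolp.

Set Implicit Arguments.
Unset Strict Implicit.
Unset Printing Implicit Defensive.

Local Open Scope fset_scope.
Local Open Scope fmap_scope.
Local Open Scope quotient_scope.

(* Terms modulo alpha-conversion are de Bruijn terms. A free variable is its
   index counted from outside all the binders of the term. *)

Inductive term : Type :=
| Var of nat
| App of term & term
| Lam of term.

Fixpoint term_size (M : term) : nat :=
  match M with
  | Var _ => 1
  | App M N => term_size M + term_size N + 1
  | Lam M => term_size M + 1
  end.

Definition up_ren (r : nat -> nat) (k : nat) : nat :=
  if k is j.+1 then (r j).+1 else 0.

Fixpoint rename (r : nat -> nat) (M : term) : term :=
  match M with
  | Var k => Var (r k)
  | App M N => App (rename r M) (rename r N)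
  | Lam M => Lam (rename (up_ren r) M)
  end.

Definition up_subst (f : nat -> term) (k : nat) : term :=
  if k is j.+1 then rename succn (f j) else Var 0.

Fixpoint subst (f : nat -> term) (M : term) : term :=
  match M with
  | Var k => f k
  | App M N => App (subst f M) (subst f N)
  | Lam M => Lam (subst (up_subst f) M)
  end.

(* M[N/x] for the body M of an abstraction whose bound variable is x *)
Definition inst (M N : term) : term :=
  subst (fun k => if k is j.+1 then Var j else N) M.

(* M[x/x_1, ..., x/x_n] *)
Definition merge_vars (x : nat) (xs : seq nat) (M : term) : term :=
  rename (fun y => if y \in xs then x else y) M.

Inductive beta : term -> term -> Prop :=
| beta_redex M N : beta (App (Lam M) N) (inst M N)
| beta_appl M M' N : beta M M' -> beta (App M N) (App M' N)
| beta_appr M N N' : beta N N' -> beta (App M N) (App M N')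
| beta_lam M M' : beta M M' -> beta (Lam M) (Lam M').

Inductive beta_steps : nat -> term -> term -> Prop :=
| beta_steps0 M : beta_steps 0 M M
| beta_stepsS n M M1 M' :
    beta M M1 -> beta_steps n M1 M' -> beta_steps n.+1 M M'.

(* Syntax trees of linear and intersection types. [pInter s1 s2 [:: s3; ...]]
   is s1 /\ s2 /\ s3 /\ ...: an intersection has at least two components. *)

Inductive pltype : Type :=
| pTVar of nat
| pArr of pitype & pltype
with pitype : Type :=
| pLin of pltype
| pInter of pitype & pitype & seq pitype.

(* Equality of types up to commutativity of each intersection: the least
   congruence that allows the components of an intersection to be permuted.
   The relation [msim] is "permutation up to [isim]" on lists. *)

Inductive lsim : pltype -> pltype -> Prop :=
| lsim_var a : lsim (pTVar a) (pTVar a)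
| lsim_arr s t A B : isim s t -> lsim A B -> lsim (pArr s A) (pArr t B)
with isim : pitype -> pitype -> Prop :=
| isim_lin A B : lsim A B -> isim (pLin A) (pLin B)
| isim_inter s1 s2 ss t1 t2 ts :
    msim [:: s1, s2 & ss] [:: t1, t2 & ts] ->
    isim (pInter s1 s2 ss) (pInter t1 t2 ts)
with msim : seq pitype -> seq pitype -> Prop :=
| msim_nil : msim [::] [::]
| msim_cons s t ss ts : isim s t -> msim ss ts -> msim (s :: ss) (t :: ts)
| msim_swap s t s' t' ss ts : isim s s' -> isim t t' -> msim ss ts ->
    msim [:: s, t & ss] [:: t', s' & ts]
| msim_trans ss ts us : msim ss ts -> msim ts us -> msim ss us.

Scheme lsim_mut := Induction for lsim Sort Prop
with isim_mut := Induction for isim Sort Prop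
with msim_mut := Induction for msim Sort Prop.
Combined Scheme sim_mut from lsim_mut, isim_mut, msim_mut.

Fixpoint lsim_refl (A : pltype) : lsim A A
with isim_refl (s : pitype) : isim s s.
Proof.
- by case: A => [a|s A]; [exact: lsim_var | exact: lsim_arr].
- case: s => [A|s1 s2 ss]; first exact/isim_lin/lsim_refl.
  apply: isim_inter; apply: msim_cons; first exact: isim_refl.
  apply: msim_cons; first exact: isim_refl.
  elim: ss => [|s ss IHss]; first exact: msim_nil.
  by apply: msim_cons.
Qed.

Lemma sim_sym :
  (forall A B, lsim A B -> lsim B A) /\ (forall s t, isim s t -> isim t s) /\
  (forall ss ts, msim ss ts -> msim ts ss).
Proof.
apply: sim_mut; try by [econstructor; eauto].
Qed.

Lemma sim_trans :
  (forall A B, lsim A B -> forall C, lsim B C -> lsim A C) /\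
  (forall s t, isim s t -> forall u, isim t u -> isim s u) /\
  (forall ss ts, msim ss ts -> True).
Proof.
apply: sim_mut => //.
- move=> s t A B _ IHs _ IHA C BC; inversion BC; subst.
  by apply: lsim_arr; [apply: IHs | apply: IHA].
- by move=> A B _ IHA u Bu; inversion Bu; subst; apply/isim_lin/IHA.
- move=> s1 s2 ss t1 t2 ts st _ u tu; inversion tu; subst.
  by apply: isim_inter; apply: msim_trans st _.
Qed.

Lemma lsim_equiv : equiv_class_of (fun A B => `[< lsim A B >]).
Proof.
split=> [A|A B|B A C /asboolP AB /asboolP BC].
- exact/asboolP/lsim_refl.
- by apply/asboolP/asboolP; apply: sim_sym.1.
- by apply/asboolP/(sim_trans.1 _ _ AB).
Qed.

Lemma isim_equiv : equiv_class_of (fun s t => `[< isim s t >]).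
Proof.
split=> [s|s t|t s u /asboolP st /asboolP tu].
- exact/asboolP/isim_refl.
- by apply/asboolP/asboolP; apply: sim_sym.2.1.
- by apply/asboolP/(sim_trans.2.1 _ _ st).
Qed.

HB.instance Definition _ := gen_eqMixin pltype.
HB.instance Definition _ := gen_choiceMixin pltype.
HB.instance Definition _ := gen_eqMixin pitype.
HB.instance Definition _ := gen_choiceMixin pitype.

Definition lsim_equivRel := EquivRelPack lsim_equiv.
Definition isim_equivRel := EquivRelPack isim_equiv.

Definition ltype := {eq_quot lsim_equivRel}.
Definition itype := {eq_quot isim_equivRel}.

HB.instance Definition _ := EqQuotient.on ltype.
HB.instance Definition _ := Choice.on ltype.
HB.instance Definition _ := EqQuotient.on itype.
HB.instance Definition _ := Choice.on itype.

Definition tvar (a : nat) : ltype := \pi_ltype (pTVar a).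
Definition arr (s : itype) (A : ltype) : ltype := \pi_ltype (pArr (repr s) (repr A)).
Definition lin (A : ltype) : itype := \pi_itype (pLin (repr A)).

(* The n-ary intersection. For n = 1 this is the type itself, which is needed
   for intersections of contexts; the value for n = 0 is a dummy. *)
Definition inter (ss : seq itype) : itype :=
  match ss with
  | [::] => lin (tvar 0)
  | [:: s] => s
  | [:: s1, s2 & ss'] => \pi_itype (pInter (repr s1) (repr s2) (map repr ss'))
  end.

Definition ctx := {fmap nat -> itype}.

Definition ctx1 (x : nat) (s : itype) : ctx := [fmap].[x <- s].

(* x_1 : s_1, ..., x_n : s_n *)
Definition ctx_zip (xs : seq nat) (ss : seq itype) : ctx :=
  foldr (fun p (G : ctx) => G.[p.1 <- p.2]) [fmap] (zip xs ss).

(* The context Gamma, x : s seen from under the binder of x: x becomes 0 and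
   the variables of Gamma are shifted. The default of [odflt] is not used. *)
Definition ctx_push (s : itype) (G : ctx) : ctx :=
  [fmap x : (0%N |` [fset k.+1 | k in domf G]) =>
     if val x is k.+1 then odflt s G.[? k] else s].

(* The intersection of contexts: a variable is given the intersection of the
   types it has in those contexts where it is declared. *)
Definition ctx_inter (Gs : seq ctx) : ctx :=
  [fmap x : (\bigcup_(G <- Gs) domf G) =>
     inter (pmap (fun G : ctx => G.[? val x]) Gs)].

Lemma ctx_push0 s G : (ctx_push s G).[? 0] = Some s.
Proof.
have k0 : 0%N \in ctx_push s G by rewrite in_fset1U.
by rewrite (in_fnd k0) ffunE.
Qed.

Lemma ctx_pushS s G k : (ctx_push s G).[? k.+1] = G.[? k].
Proof.
have mem_k : (k.+1 \in ctx_push s G) = (k \in G).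
  by rewrite in_fset1U /=; apply/imfsetP/idP => [[j ? [->]]|?]; last exists k.
have [kG|kG] := boolP (k \in G); last by rewrite !not_fnd ?mem_k.
have kP : k.+1 \in ctx_push s G by rewrite mem_k.
by rewrite (in_fnd kP) ffunE /= (in_fnd kG).
Qed.

(* Derivations. In [d_mux] the merged variable x may be one of the x_i. *)
Inductive deriv : ctx -> term -> itype -> Type :=
| d_ax x (A : ltype) : deriv (ctx1 x (lin A)) (Var x) (lin A)
| d_weak (G : ctx) M s x (A : ltype) :
    x \notin domf G -> deriv G M s -> deriv (G + ctx1 x (lin A)) M s
| d_arrI (G : ctx) M s (A : ltype) :
    deriv (ctx_push s G) M (lin A) -> deriv G (Lam M) (lin (arr s A))
| d_arrE (G D : ctx) M N s (A : ltype) :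
    [disjoint domf G & domf D] ->
    deriv G M (lin (arr s A)) -> deriv D N s -> deriv (G + D) (App M N) (lin A)
| d_inter n (Gs : n.-tuple ctx) M (ss : n.-tuple itype) :
    1 < n -> (forall i : 'I_n, deriv (tnth Gs i) M (tnth ss i)) ->
    deriv (ctx_inter Gs) M (inter ss)
| d_mux n (G : ctx) (x : nat) (xs : n.-tuple nat) (ss : n.-tuple itype) M t :
    1 < n -> uniq xs -> all (fun y => y \notin domf G) xs ->
    x \notin domf G ->
    deriv (G + ctx_zip xs ss) M t ->
    deriv (G + ctx1 x (inter ss)) (merge_vars x xs M) t.

Fixpoint degree G M s (P : deriv G M s) : nat :=
  match P with
  | d_ax _ _ => 0
  | d_weak _ _ _ _ _ _ Q => degree Q
  | d_arrI _ _ _ _ Q => degree Q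
  | d_arrE _ _ _ _ _ _ _ Q1 Q2 => maxn (degree Q1) (degree Q2)
  | d_inter n _ _ _ _ Q => (\max_(i < n) degree (Q i)).+1
  | d_mux _ _ _ _ _ _ _ _ _ _ _ Q => degree Q
  end.

(* Main.v *)
Require Import Defs.
From mathcomp Require Import all_boot.
From mathcomp Require Import generic_quotient finmap boolp zify.

Set Implicit Arguments.
Unset Strict Implicit.
Unset Printing Implicit Defensive.

(** Idea.  Let [cost M] be [term_size M - 1].  Beta-reduction is compared with a
non-erasing calculus on the same terms: [(\_. M) N] is never contracted, but
kept as "[M] together with the garbage [N]", and moved out of the way by the
permutation [((\_. M) N) P -> (\_. M P) N].  A reduct of [M] is then a reduct in
this calculus stripped of garbage, and each erasing step leaves a garbage node,
so that bounding the number of steps plus the final cost in the non-erasing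
calculus bounds both [n] and [M'].

That bound [w] comes from a quantitative reducibility predicate "[T] has type [s]
with weight [w]".  Given [r], weights add up through arrows, and [T] has an
intersection type with weight [w] when it has each component with weight
[w %/ r].  If [term_size M <= r], a derivation [P] of [M] yields the weight
[cost M * r ^ degree P] plus the weights of the terms substituted for the
variables that occur in [M]: a multiplexor merges at most [r] occurring
variables, and an intersection rule multiplies all weights by [r].  Variables
have weight 0, hence the theorem with [r = term_size M]. *)

(** * Occurrences, cost, renaming and substitution *)

Fixpoint occ (x : nat) (M : term) : bool :=
  match M with
  | Var k => k == x
  | App M N => occ x M || occ x N
  | Lam M => occ x.+1 M
  end.

Fixpoint cost (M : term) : nat :=
  match M with
  | Var _ => 0
  | App M N => cost M + cost N + 2
  | Lam M => cost M + 1
  end.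

Lemma term_sizeE M : term_size M = (cost M).+1.
Proof. by elim: M => //= [M -> N ->|M ->]; lia. Qed.

Definition scons (N : term) (f : nat -> term) (k : nat) : term :=
  if k is j.+1 then f j else N.

Lemma instE M N : inst M N = subst (scons N Var) M.
Proof. by []. Qed.

Lemma subst_rename f r M : subst f (rename r M) = subst (f \o r) M.
Proof.
elim: M f r => //= [M IHM N IHN|M IHM] f r; first by rewrite IHM IHN.
by rewrite IHM; congr (Lam (subst _ _)); apply/funext => -[].
Qed.

Lemma rename_rename r1 r2 M : rename r1 (rename r2 M) = rename (r1 \o r2) M.
Proof.
elim: M r1 r2 => //= [M IHM N IHN|M IHM] r1 r2; first by rewrite IHM IHN.
by rewrite IHM; congr (Lam (rename _ _)); apply/funext => -[].
Qed.

Lemma rename_subst r f M : rename r (subst f M) = subst (rename r \o f) M.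
Proof.
elim: M f r => //= [M IHM N IHN|M IHM] f r; first by rewrite IHM IHN.
rewrite IHM; congr (Lam (subst _ _)); apply/funext => -[|x] //=.
by rewrite !rename_rename.
Qed.

Lemma subst_subst g f M : subst g (subst f M) = subst (subst g \o f) M.
Proof.
elim: M f g => //= [M IHM N IHN|M IHM] f g; first by rewrite IHM IHN.
rewrite IHM; congr (Lam (subst _ _)); apply/funext => -[|x] //=.
by rewrite subst_rename rename_subst.
Qed.

Lemma up_subst_Var : up_subst Var = Var.
Proof. by apply/funext => -[]. Qed.

Lemma subst_Var M : subst Var M = M.
Proof. by elim: M => //= [M -> N ->|M IHM] //; rewrite up_subst_Var IHM. Qed.

Lemma rename_as_subst r M : rename r M = subst (Var \o r) M.
Proof. by rewrite -[RHS](subst_rename Var) subst_Var. Qed.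

Lemma inst_shift M N : inst (rename succn M) N = M.
Proof. by rewrite instE subst_rename -[RHS]subst_Var. Qed.

Lemma inst_up_subst f M N : inst (subst (up_subst f) M) N = subst (scons N f) M.
Proof.
rewrite instE subst_subst; congr subst; apply/funext => -[|x] //=.
exact: inst_shift.
Qed.

Lemma subst_inst f M N :
  subst f (inst M N) = inst (subst (up_subst f) M) (subst f N).
Proof.
by rewrite inst_up_subst instE subst_subst; congr subst; apply/funext => -[].
Qed.

Lemma subst_up_shift f M :
  subst (up_subst f) (rename succn M) = rename succn (subst f M).
Proof. by rewrite subst_rename rename_subst. Qed.

Lemma occ_rename M r x :
  reflect (exists2 y, occ y M & r y = x) (occ x (rename r M)).
Proof.
apply: (iffP idP).
- elim: M r x => /= [k|M IHM N IHN|M IHM] r x.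
  + by move/eqP <-; exists k.
  + by case/orP => [/IHM|/IHN] [y yM xy]; exists y => //; rewrite yM ?orbT.
  + by move/IHM => [[|y] yM //= [<-]]; exists y.
- case=> y yM <-; elim: M r y yM => /= [k|M IHM N IHN|M IHM] r y.
  + by move/eqP ->.
  + by case/orP => [/IHM|/IHN] ->; rewrite ?orbT.
  + by move=> yM; apply: (IHM (up_ren r) y.+1).
Qed.

Lemma occ_subst M f x :
  reflect (exists2 y, occ y M & occ x (f y)) (occ x (subst f M)).
Proof.
apply: (iffP idP).
- elim: M f x => /= [k|M IHM N IHN|M IHM] f x.
  + by exists k.
  + by case/orP => [/IHM|/IHN] [y yM xy]; exists y => //; rewrite yM ?orbT.
  + by move/IHM => [[|y] yM //= /occ_rename[z zy [<-]]]; exists y.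
- case=> y; elim: M f x y => /= [k|M IHM N IHN|M IHM] f x y.
  + by move/eqP ->.
  + case/orP => yM xy; first by rewrite (IHM _ _ _ yM xy).
    by rewrite (IHN _ _ _ yM xy) orbT.
  + by move=> yM xy; apply: (IHM _ _ _ yM); apply/occ_rename; exists x.
Qed.

Lemma occ_shift x M : occ x.+1 (rename succn M) = occ x M.
Proof. by apply/occ_rename/idP => [[y yM [<-]]|]; last exists x. Qed.

Lemma occ0_shift M : occ 0 (rename succn M) = false.
Proof. by apply/occ_rename => -[]. Qed.

Lemma occ0_up_subst f M : occ 0 (subst (up_subst f) M) = occ 0 M.
Proof.
apply/occ_subst/idP => [[[|y] yM //=]|M0]; last by exists 0.
by rewrite occ0_shift.
Qed.

Lemma occ_inst x M N :
  occ x (inst M N) = occ x.+1 M || occ 0 M && occ x N.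
Proof.
apply/occ_subst/orP => [[[|y] yM /=]|[xM|/andP[M0 xN]]].
- by right; rewrite yM.
- by move/eqP <-; left.
- by exists x.+1 => //=; rewrite eqxx.
- by exists 0.
Qed.

Lemma eq_subst_occ M f g :
  (forall x, occ x M -> f x = g x) -> subst f M = subst g M.
Proof.
elim: M f g => /= [k|M IHM N IHN|M IHM] f g fg; first by apply: fg.
- by congr App; [apply: IHM|apply: IHN] => x xM; apply: fg; rewrite xM ?orbT.
- by congr Lam; apply: IHM => -[|x] xM //=; rewrite fg.
Qed.

Lemma cost_rename r M : cost (rename r M) = cost M.
Proof. by elim: M r => //= [M IHM N IHN|M IHM] r; rewrite ?IHM ?IHN. Qed.

(** Variables cost 0, so substituting never lowers the cost, and at least one copy of [f x] is
    inserted when [x] occurs. *)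
Lemma cost_subst f M x : cost M + occ x M * cost (f x) <= cost (subst f M).
Proof.
elim: M f x => /= [k|M IHM N IHN|M IHM] f x.
- by case: eqP => [->|_]; rewrite ?mul1n ?mul0n.
- by move: (IHM f x) (IHN f x); case: occ; case: occ => /=; lia.
- by move: (IHM (up_subst f) x.+1) => /=; rewrite cost_rename; lia.
Qed.

(** * The non-erasing calculus *)

(* The first index counts the [mstep_beta] steps; permutations are free. *)
Inductive mstep : nat -> term -> term -> Prop :=
| mstep_beta M N : occ 0 M -> mstep 1 (App (Lam M) N) (inst M N)
| mstep_perm M N P : ~~ occ 0 M ->
    mstep 0 (App (App (Lam M) N) P) (App (Lam (App M (rename succn P))) N)
| mstep_appl n M M' N : mstep n M M' -> mstep n (App M N) (App M' N)
| mstep_appr n M N N' : mstep n N N' -> mstep n (App M N) (App M N')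
| mstep_lam n M M' : mstep n M M' -> mstep n (Lam M) (Lam M').

Lemma mstep_LamE n M T :
  mstep n (Lam M) T -> exists2 M', T = Lam M' & mstep n M M'.
Proof. by move=> h; inversion h; subst; eexists. Qed.

Lemma mstep_AppE n M N T : mstep n (App M N) T ->
  [\/ exists M1, [/\ M = Lam M1, occ 0 M1, n = 1 & T = inst M1 N],
      exists M1 N1, [/\ M = App (Lam M1) N1, ~~ occ 0 M1, n = 0 &
                        T = App (Lam (App M1 (rename succn N))) N1],
      exists2 M', T = App M' N & mstep n M M' |
      exists2 N', T = App M N' & mstep n N N'].
Proof.
move=> h; inversion h; subst.
- by constructor 1; exists M0.
- by constructor 2; exists M0, N0.
- by constructor 3; exists M'.
- by constructor 4; exists N'.
Qed.

Inductive msteps : nat -> term -> term -> Prop :=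
| msteps0 M : msteps 0 M M
| mstepsS m n M M1 M' : mstep m M M1 -> msteps n M1 M' -> msteps (m + n) M M'.

Lemma msteps1 n M M' : mstep n M M' -> msteps n M M'.
Proof. by move=> h; rewrite -[n]addn0; apply: mstepsS h (msteps0 _). Qed.

Lemma msteps_trans m n M M1 M' :
  msteps m M M1 -> msteps n M1 M' -> msteps (m + n) M M'.
Proof.
move=> h; elim: h n M' => // {M M1}m1 m2 M M1 M2 h _ IH n M' h'.
by rewrite -addnA; apply: mstepsS h (IH _ _ h').
Qed.

Lemma msteps_appl n M M' N : msteps n M M' -> msteps n (App M N) (App M' N).
Proof.
by elim=> [*|*]; [exact: msteps0 | apply: mstepsS; eauto; constructor].
Qed.

Lemma msteps_appr n M N N' : msteps n N N' -> msteps n (App M N) (App M N').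
Proof.
by elim=> [*|*]; [exact: msteps0 | apply: mstepsS; eauto; constructor].
Qed.

Lemma msteps_lam n M M' : msteps n M M' -> msteps n (Lam M) (Lam M').
Proof.
by elim=> [*|*]; [exact: msteps0 | apply: mstepsS; eauto; constructor].
Qed.

(** Nothing is erased: a redex is contracted only if its bound variable occurs, so its argument
    survives. *)
Lemma mstep_occ n M M' x : mstep n M M' -> occ x M' = occ x M.
Proof.
move=> h; elim: h x => {n M M'} /=.
- by move=> M N M0 x; rewrite occ_inst M0.
- by move=> M N P M0 x; rewrite occ_shift orbAC.
- by move=> n M M' N _ IH x; rewrite IH.
- by move=> n M M' N _ IH x; rewrite IH.
- by move=> n M M' _ IH x; rewrite IH.
Qed.

Lemma msteps_occ n M M' x : msteps n M M' -> occ x M' = occ x M.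
Proof. by elim=> // {n M M'} m n M M1 M' /(mstep_occ x) -> _ ->. Qed.

Lemma mstep_subst n f M M' :
  mstep n M M' -> mstep n (subst f M) (subst f M').
Proof.
move=> h; elim: h f => {n M M'} /=; try by move=> *; constructor.
- move=> M N M0 f; rewrite subst_inst; apply: mstep_beta.
  by rewrite occ0_up_subst.
- move=> M N P M0 f; rewrite subst_up_shift; apply: mstep_perm.
  by rewrite occ0_up_subst.
Qed.

Lemma mstep_rename n r M M' :
  mstep n M M' -> mstep n (rename r M) (rename r M').
Proof. by rewrite !rename_as_subst; apply: mstep_subst. Qed.

(** The step is replayed in every copy of [f x]; a single occurrence of [x] already yields [n] beta
    steps. *)
Lemma msteps_subst_arg n f f' x M :
    mstep n (f x) (f' x) -> (forall y, y != x -> f y = f' y) ->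
  exists2 m, msteps m (subst f M) (subst f' M) & occ x M -> n <= m.
Proof.
elim: M f f' x => /= [k|M IHM N IHN|M IHM] f f' x fx fy.
- case: (eqVneq k x) => [->|/fy ->]; last by exists 0 => //; exact: msteps0.
  by exists n => //; exact: msteps1.
- have [m1 h1 le1] := IHM _ _ _ fx fy; have [m2 h2 le2] := IHN _ _ _ fx fy.
  exists (m1 + m2) => [|/orP[/le1|/le2]]; try by lia.
  by apply: msteps_trans (msteps_appl _ h1) (msteps_appr _ h2).
- have [] := IHM (up_subst f) (up_subst f') x.+1.
  + exact: mstep_rename.
  + by case=> [|y] //= xy; rewrite fy.
  + by move=> m h le; exists m => //; apply: msteps_lam.
Qed.

Lemma msteps_inst_arg n M N N' : mstep n N N' ->
  exists2 m, msteps m (inst M N) (inst M N') & occ 0 M -> n <= m.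
Proof. by move=> h; apply: msteps_subst_arg => //= -[]. Qed.

(** * Terms decorated with garbage, and simulation of beta-reduction *)

(* [emb g M T]: [T] is [M] decorated with garbage containing [g] garbage nodes.
   Nodes inside garbage are counted too (whence [N], of which [U] is a
   decoration), so that [g] does not drop when a variable that survives only in
   garbage is substituted. *)
Inductive emb : nat -> term -> term -> Prop :=
| emb_var x : emb 0 (Var x) (Var x)
| emb_app g h M T N U :
    emb g M T -> emb h N U -> emb (g + h) (App M N) (App T U)
| emb_lam g M T : emb g M T -> emb g (Lam M) (Lam T)
| emb_mem g h M T N U : ~~ occ 0 T -> emb g (rename succn M) T -> emb h N U ->
    emb (g + h).+1 M (App (Lam T) U).

Lemma emb_refl M : emb 0 M M.
Proof.
elim: M => [x|M IHM N IHN|M IHM]; try by constructor.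
by rewrite -[0]addn0; constructor.
Qed.

(** Each garbage node adds an abstraction and an application, so the final cost also pays for the
    garbage count. *)
Lemma emb_cost g M T : emb g M T -> cost M + g <= cost T.
Proof.
by elim=> //= *; repeat match goal with H : context [rename] |- _ =>
  rewrite cost_rename in H end; lia.
Qed.

Lemma emb_occ g M T x : emb g M T -> occ x M -> occ x T.
Proof.
move=> h; elim: h x => {g M T} //=.
- by move=> g h M T N U _ IHM _ IHN x /orP[/IHM->|/IHN->]; rewrite ?orbT.
- by move=> g M T _ IHM x /IHM.
- by move=> g h M T N U _ _ IHM _ _ x xM; rewrite IHM // occ_shift.
Qed.

Lemma shift_inst M N : ~~ occ 0 M -> rename succn (inst M N) = M.
Proof.
move=> M0; rewrite instE rename_subst -[RHS]subst_Var.
by apply: eq_subst_occ => -[|x] //; rewrite (negbTE M0).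
Qed.

Lemma rename_up_shift r M :
  rename (up_ren r) (rename succn M) = rename succn (rename r M).
Proof. by rewrite !rename_rename. Qed.

Lemma occ0_up_ren r M : occ 0 (rename (up_ren r) M) = occ 0 M.
Proof. by apply/occ_rename/idP => [[[|y] //]|M0]; last by exists 0. Qed.

Lemma emb_rename g r M T : emb g M T -> emb g (rename r M) (rename r T).
Proof.
move=> h; elim: h r => {g M T} /=; try by [constructor; eauto].
move=> g h M T N U T0 _ IHM _ IHN r; apply: emb_mem (IHN r).
- by rewrite occ0_up_ren.
- by rewrite -rename_up_shift; apply: IHM.
Qed.

(** The gain [h x] is claimed for [x] occurring in [T], not just in [M]: a copy substituted inside
    garbage keeps its own garbage nodes in the count. *)
Lemma emb_subst g M T f f' h :
    emb g M T -> (forall x, emb (h x) (f x) (f' x)) ->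
  exists2 g', emb g' (subst f M) (subst f' T) &
    g <= g' /\ forall x, occ x T -> g + h x <= g'.
Proof.
move=> MT; have up_f f1 f1' h1 : (forall x, emb (h1 x) (f1 x) (f1' x)) ->
    forall x, emb (if x is y.+1 then h1 y else 0)
                  (up_subst f1 x) (up_subst f1' x).
  by move=> ff [|x] /=; [exact: emb_var | exact: emb_rename].
elim: MT f f' h => {g M T} /=.
- by move=> x f f' h ff; exists (h x) => //; split=> // y /eqP->.
- move=> g k M T N U _ IHM _ IHN f f' h ff.
  have [g1 e1 [le1 o1]] := IHM _ _ _ ff; have [g2 e2 [le2 o2]] := IHN _ _ _ ff.
  exists (g1 + g2); first exact: emb_app.
  by split=> [|x /orP[/o1|/o2]]; lia.
- move=> g M T _ IHM f f' h ff.
  have [g1 e1 [le1 o1]] := IHM _ _ _ (up_f _ _ _ ff).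
  by exists g1; [exact: emb_lam | split=> // x /o1].
- move=> g k M T N U T0 _ IHM _ IHN f f' h ff.
  have [g1 e1 [le1 o1]] := IHM _ _ _ (up_f _ _ _ ff).
  have [g2 e2 [le2 o2]] := IHN _ _ _ ff.
  exists (g1 + g2).+1; last by split=> [|x /orP[/o1|/o2]] /=; lia.
  apply: emb_mem e2; first by rewrite occ0_up_subst.
  by rewrite -subst_up_shift.
Qed.

Lemma emb_inst g h M T N U : emb g M T -> emb h N U ->
  exists2 g', emb g' (inst M N) (inst T U) & g + occ 0 T * h <= g'.
Proof.
move=> MT NU; have [|g' e [le0 le1]] := @emb_subst g M T (scons N Var)
  (scons U Var) (fun x => if x is 0 then h else 0) MT.
  by case=> //= x; exact: emb_var.
by exists g' => //; case: (occ 0 T) (le1 0) => /=; lia.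
Qed.

Lemma rename_inst r M N :
  rename r (inst M N) = inst (rename (up_ren r) M) (rename r N).
Proof.
have up_r : Var \o up_ren r = up_subst (Var \o r) by apply/funext => -[].
by rewrite !rename_as_subst up_r subst_inst.
Qed.

Lemma beta_rename r M M' : beta M M' -> beta (rename r M) (rename r M').
Proof.
move=> h; elim: h r => {M M'} /=; try by [constructor; eauto].
by move=> M N r; rewrite rename_inst; constructor.
Qed.

(** [T] is an abstraction wrapped in garbage nodes. Permutations carry the argument inwards through
    them. At the abstraction, either the bound variable occurs and the redex is contracted, for one
    step, or the redex is left in place as one more garbage node. Either way steps plus garbage
    strictly increase. *)
Lemma emb_beta_redex g h M T N U : emb g (Lam M) T -> emb h N U ->
  exists m T' g',
    [/\ msteps m (App T U) T', emb g' (inst M N) T' & g + h < m + g'].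
Proof.
move E: (Lam M) => L LT; elim: LT M E h N U => {g L T} //.
- move=> g M T MT _ _ [->] h N U NU; have [g' e le] := emb_inst MT NU.
  have [T0|T0] := boolP (occ 0 T).
    exists 1, (inst T U), g'; split=> //; first exact/msteps1/mstep_beta.
    by move: le; rewrite T0; lia.
  exists 0, (App (Lam T) U), (g + h).+1; split=> //; first exact: msteps0.
  apply: emb_mem NU => //.
  by rewrite shift_inst //; apply: contra T0; exact: emb_occ MT.
- move=> g k L T V W T0 _ IHT VW _ M LE h N U NU; subst L.
  have [m [T' [g' [st e le]]]] := IHT _ erefl _ _ _ (emb_rename succn NU).
  exists m, (App (Lam T') W), (g' + k).+1; split; last by lia.
  + rewrite -[m]add0n; apply: mstepsS (mstep_perm _ _ T0) _.
    by apply/msteps_appl/msteps_lam.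
  + apply: emb_mem VW; first by rewrite (msteps_occ _ st) /= occ0_shift orbF.
    by rewrite rename_inst.
Qed.

(** Each beta step raises steps plus garbage by at least one. Below a garbage node the step is
    shifted and simulated in its body. *)
Lemma beta_emb g M M' T : emb g M T -> beta M M' ->
  exists m T' g', [/\ msteps m T T', emb g' M' T' & g < m + g'].
Proof.
move=> MT; elim: MT M' => {g M T}.
- by move=> x M' h; inversion h.
- move=> g h M T N U MT IHM NU IHN M' st; inversion st; subst.
  + exact: emb_beta_redex NU.
  + have [m [T' [g' [st' e le]]]] := IHM _ H2.
    exists m, (App T' U), (g' + h).
    by split; [exact: msteps_appl | exact: emb_app | lia].
  + have [m [U' [h' [st' e le]]]] := IHN _ H2.
    exists m, (App T U'), (g + h').
    by split; [exact: msteps_appr | exact: emb_app | lia].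
- move=> g M T _ IHM M' st; inversion st; subst.
  have [m [T' [g' [st' e le]]]] := IHM _ H0.
  by exists m, (Lam T'), g'; split=> //; [exact: msteps_lam | exact: emb_lam].
- move=> g h M T N U T0 _ IHM NU _ M' st.
  have [m [T' [g' [st' e le]]]] := IHM _ (beta_rename succn st).
  exists m, (App (Lam T') U), (g' + h).+1; split; last by lia.
  + exact/msteps_appl/msteps_lam.
  + by apply: emb_mem NU => //; rewrite (msteps_occ _ st').
Qed.

Lemma beta_steps_emb n M M' g T : beta_steps n M M' -> emb g M T ->
  exists m T' g', [/\ msteps m T T', emb g' M' T' & n + g <= m + g'].
Proof.
move=> st; elim: st g T => {n M M'} [M g T MT|n M M1 M' st _ IH g T MT].
  by exists 0, T, g; split=> //; exact: msteps0.
have [m1 [T1 [g1 [st1 e1 le1]]]] := beta_emb MT st.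
have [m [T' [g' [st' e le]]]] := IH _ _ e1.
by exists (m1 + m), T', g'; split=> //; [exact: msteps_trans st1 st' | lia].
Qed.

(** * Bounds and reducibility *)

(** Steps and final cost share one budget, so a single number controls both parts of the theorem. *)
Definition bounded (T : term) (w : nat) : Prop :=
  forall n T', msteps n T T' -> n + cost T' <= w.

(** Starting without garbage, [n] is at most the simulated steps plus the final garbage [g], and
    stripping [g] nodes lowers the cost by at least [g]. *)
Lemma bounded_beta_steps M w n M' :
  bounded M w -> beta_steps n M M' -> n + cost M' <= w.
Proof.
move=> Mw st.
have [m [T [g [mT /emb_cost le]]]] := beta_steps_emb st (emb_refl M).
by move: (Mw _ _ mT); lia.
Qed.

Lemma bounded_cost T w : bounded T w -> cost T <= w.
Proof. by move/(_ _ _ (msteps0 T)). Qed.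

Lemma bounded_msteps T w n T' :
  bounded T w -> msteps n T T' -> exists2 w', bounded T' w' & n + w' <= w.
Proof.
move=> Tw st; exists (w - n) => [m T1 st1|].
  by have := Tw _ _ (msteps_trans st st1); lia.
by have := Tw _ _ st; lia.
Qed.

(** Reductions are finite, so it is enough that [R] survives each step with the step deducted from
    the budget. *)
Lemma bounded_coind (R : term -> nat -> Prop) :
    (forall T w, R T w -> cost T <= w /\ forall n T', mstep n T T' ->
       exists2 w', R T' w' & n + w' <= w) ->
  forall T w, R T w -> bounded T w.
Proof.
move=> HR T w Tw n T' st; elim: st w Tw => {n T T'} [T w /HR[]//|].
move=> m n T T1 T' st _ IH w /HR[_ /(_ _ _ st)[w' /IH le le']].
by lia.
Qed.

Lemma bounded_leq T w w' : w <= w' -> bounded T w -> bounded T w'.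
Proof. by move=> le Tw n T' /Tw; lia. Qed.

(** Terms with a head variable: applied to an argument, they create neither a beta-redex nor a
    permutation. *)
Fixpoint neutral (M : term) : bool :=
  match M with
  | Var _ => true
  | App M _ => neutral M
  | Lam _ => false
  end.

Lemma neutral_mstep n M M' : mstep n M M' -> neutral M -> neutral M'.
Proof. by elim. Qed.

Lemma bounded_neutral_app M N a b : neutral M -> bounded M a -> bounded N b ->
  bounded (App M N) (a + b + 2).
Proof.
move=> M0 Ma Nb; pose R T w := exists M N a b,
  [/\ T = App M N, neutral M, bounded M a, bounded N b & w = a + b + 2].
apply: (@bounded_coind R); last by exists M, N, a, b.
move=> _ _ {M N a b M0 Ma Nb}[M [N [a [b [-> M0 Ma Nb ->]]]]]; split=> /=.
  by move: (bounded_cost Ma) (bounded_cost Nb); lia.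
move=> n T' /mstep_AppE[[? [EM]]|[? [? [EM]]]|[M' -> st]|[N' -> st]].
- by rewrite EM in M0.
- by rewrite EM in M0.
- have [a' Ma' le] := bounded_msteps Ma (msteps1 st).
  exists (a' + b + 2); last by lia.
  by exists M', N, a', b; split=> //; exact: neutral_mstep st M0.
- have [b' Nb' le] := bounded_msteps Nb (msteps1 st).
  by exists (a + b' + 2); [exists M, N', a, b' | lia].
Qed.

(* The argument of a garbage node contributes its own bound, as it is not a
   subterm of the contractum. *)
Inductive head_exp : nat -> term -> term -> Prop :=
| head_exp_occ M N : occ 0 M -> head_exp 3 (App (Lam M) N) (inst M N)
| head_exp_drop v M N : ~~ occ 0 M -> bounded N v ->
    head_exp (v + 3) (App (Lam M) N) (inst M N)
| head_exp_app e T2 T1 P :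
    head_exp e T2 T1 -> head_exp e (App T2 P) (App T1 P).

Lemma head_exp_cost e T2 T1 : head_exp e T2 T1 -> cost T2 <= cost T1 + e.
Proof.
elim=> {e T1 T2} /=.
- move=> M N M0.
  by move: (cost_subst (scons N Var) M 0); rewrite M0 -instE /=; lia.
- move=> v M N _ /bounded_cost.
  by move: (cost_subst (scons N Var) M 0); rewrite -instE /=; lia.
- by move=> *; lia.
Qed.

(** A step of the expanded term is the head contraction itself, or it can be followed by [T1] while
    a head expansion remains. The inequality says that steps which [T1] does not follow are paid out
    of [e]. *)
Lemma head_exp_mstep e T2 T1 b T2' : head_exp e T2 T1 -> mstep b T2 T2' ->
  (T2' = T1 /\ b <= e) \/
  exists T1' e' m, [/\ msteps m T1 T1', head_exp e' T2' T1' & e' + b <= e + m].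
Proof.
move=> h; elim: h b T2' => {e T2 T1}.
- move=> M N M0 b T2'.
  move=> /mstep_AppE[[? [[<-] _ -> ->]]|[? [? []//]]|[F ->]|[N' -> st]].
  + by left.
  + case/mstep_LamE => {F}M' -> st; right; exists (inst M' N), 3, b.
    split; [exact/msteps1/mstep_subst | | by lia].
    by apply: head_exp_occ; rewrite (mstep_occ _ st).
  + have [m st' le] := msteps_inst_arg M st.
    right; exists (inst M N'), 3, m; split=> //; first exact: head_exp_occ.
    by move: (le M0); lia.
- move=> v M N M0 Nv b T2'.
  move=> /mstep_AppE[[? [[<-] _ -> ->]]|[? [? []//]]|[F ->]|[N' -> st]].
  + by left; split=> //; lia.
  + case/mstep_LamE => {F}M' -> st; right; exists (inst M' N), (v + 3), b.
    split; [exact/msteps1/mstep_subst | | by lia].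
    by apply: head_exp_drop; rewrite // (mstep_occ _ st).
  + have [m st' _] := msteps_inst_arg M st.
    (* The contractum does not contain [N], so a step of [N] is charged to its own bound [v]. *)
    have [v' Nv' le] := bounded_msteps Nv (msteps1 st).
    right; exists (inst M N'), (v' + 3), m; split=> //; last by lia.
    exact: head_exp_drop.
- move=> e T2 T1 P h IH b T2'.
  move=> /mstep_AppE[[M [EM]]|[M [N [EM M0 -> ->]]]|[T' -> st]|[P' -> st]].
  + by subst T2; inversion h.
  + subst T2; inversion h as [? ? M0'|v ? ? _ Nv|? ? ? ? h']; subst.
    * by rewrite M0' in M0.
    (* The permutation does not change the contractum: [P], shifted under the binder, is restored by
       the instantiation. *)
    * right; exists (App (inst M N) P), (v + 3), 0.
      split; [exact: msteps0| |by lia].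
      have -> : App (inst M N) P = inst (App M (rename succn P)) N.
        by rewrite -{1}[P](inst_shift P N).
      by apply: head_exp_drop; rewrite //= occ0_shift orbF.
    * by inversion h'.
  + case: (IH _ _ st) => [[-> le]|[T1' [e' [m [st' h' le]]]]].
      by left.
    right; exists (App T1' P), e', m.
    by split=> //; [exact: msteps_appl | exact: head_exp_app].
  + right; exists (App T1 P'), e, b.
    split; [exact/msteps1/mstep_appr | exact: head_exp_app | by lia].
Qed.

Lemma bounded_head_exp e T2 T1 w :
  head_exp e T2 T1 -> bounded T1 w -> bounded T2 (w + e).
Proof.
(* The first disjunct takes over once the head redex has been contracted. *)
move=> h T1w; pose R T w := bounded T w \/
  exists T1 e w1, [/\ head_exp e T T1, bounded T1 w1 & w = w1 + e].
apply: (@bounded_coind R); last by right; exists T1, e, w.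
move=> {h T1w}{}T2 {}w [T2w|[{}T1 [{}e [w1 [h T1w ->]]]]].
  split=> [|n T' st]; first exact: bounded_cost.
  by have [w' T'w' le] := bounded_msteps T2w (msteps1 st); exists w' => //; left.
split=> [|n T' st]; first by move: (head_exp_cost h) (bounded_cost T1w); lia.
case: (head_exp_mstep h st) => [[-> le]|[T1' [e' [m [st' h' le]]]]].
  by exists w1; [left | lia].
have [w' T1w' le'] := bounded_msteps T1w st'.
by exists (w' + e'); [right; exists T1', e', w' | lia].
Qed.

Lemma bounded_Var x : bounded (Var x) 0.
Proof.
by move=> n T' st; inversion st as [|? ? ? ? ? h]; subst => //; inversion h.
Qed.

(** * Reducibility with weights *)

Section Semantics.

Variable r : nat.

(** The recursion is on syntax trees; [psem_sim] makes it meaningful on types modulo commutativity.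
    The 2 is the cost of the application node, and [w %/ r] is the share left to each of up to [r]
    uses of the term. *)
Fixpoint lsem (A : pltype) : term -> nat -> Prop :=
  match A with
  | pTVar _ => bounded
  | pArr s A => fun T w => forall N v, psem s N v -> lsem A (App T N) (w + v + 2)
  end
with psem (s : pitype) : term -> nat -> Prop :=
  match s with
  | pLin A => lsem A
  | pInter s1 s2 ss => fun T w =>
      psem s1 T (w %/ r) /\ psem s2 T (w %/ r) /\
      foldr (fun s => and (psem s T (w %/ r))) True ss
  end.

Fixpoint lsem_leq A T w w' (le : w <= w') : lsem A T w -> lsem A T w'
with psem_leq s T w w' (le : w <= w') : psem s T w -> psem s T w'.
Proof.
- case: A => [a|s A] /=; first exact: bounded_leq.
  by move=> h N v /h; apply: lsem_leq; lia.
- case: s => [A|s1 s2 ss] /=; first exact: lsem_leq.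
  have le' := leq_div2r r le => -[h1 [h2 h]].
  split; first exact: psem_leq h1.
  split; first exact: psem_leq h2.
  elim: ss h => //= s ss IH [h3 /IH h]; split=> //; exact: psem_leq h3.
Qed.

(** The four claims support each other at smaller types: an arrow is tested on a variable, which is
    reducible with weight 0 because bounded neutral terms are reducible. *)
Fixpoint lsem_bounded A T w : lsem A T w -> bounded T w
with psem_bounded s T w : psem s T w -> bounded T w
with lsem_neutral A T w : neutral T -> bounded T w -> lsem A T w
with psem_Var s x : psem s (Var x) 0.
Proof.
- case: A => [a|s A] //= h.
  have /lsem_bounded Tx := h _ _ (psem_Var s 0).
  by move=> n T' /(msteps_appl (Var 0)) /Tx /=; lia.
- case: s => [A|s1 s2 ss] /=; first exact: lsem_bounded.
  by case=> /psem_bounded + _; apply: bounded_leq; exact: leq_div.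
- case: A => [a|s A] //= T0 Tw N v /psem_bounded Nv.
  by apply: lsem_neutral => //; exact: bounded_neutral_app.
- case: s => [A|s1 s2 ss] /=.
    by apply: lsem_neutral => //; exact: bounded_Var.
  rewrite div0n; split=> //; split=> //.
  by elim: ss => //=.
Qed.

(** Head expansion persists under further arguments, which reduces the claim to type variables. *)
Lemma lsem_head_exp A e T2 T1 w :
  head_exp e T2 T1 -> lsem A T1 w -> lsem A T2 (w + e).
Proof.
elim: A e T2 T1 w => [a|s A IH] e T2 T1 w /= h; first exact: bounded_head_exp.
move=> T1w N v /T1w T1N.
have -> : w + e + v + 2 = w + v + 2 + e by lia.
by apply: IH T1N; apply: head_exp_app.
Qed.

Lemma psem_sim :
  (forall A B, lsim A B -> forall T w, lsem A T w <-> lsem B T w) /\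
  (forall s t, isim s t -> forall T w, psem s T w <-> psem t T w) /\
  (forall ss ts, msim ss ts -> forall T w,
     foldr (fun s => and (psem s T w)) True ss <->
     foldr (fun s => and (psem s T w)) True ts).
Proof.
apply: sim_mut => //=.
- move=> s t A B _ IHs _ IHA T w.
  by split=> h N v /IHs /h /IHA.
- by move=> s t ss ts _ IHs _ IHss T w; rewrite IHs IHss.
- by move=> s t s' t' ss ts _ IHs _ IHt _ IHss T w; rewrite IHs IHt IHss; tauto.
- by move=> ss ts us _ IH1 _ IH2 T w; rewrite IH1.
Qed.

Definition isem (s : itype) : term -> nat -> Prop := psem (repr s).

Lemma isem_pi s T w : isem (\pi_itype s)%qT T w <-> psem s T w.
Proof.
apply: psem_sim.2.1.
have /eqmodP/asboolP // : (\pi_itype (repr (\pi_itype s)) = \pi_itype s)%qT.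
by rewrite reprK.
Qed.

Lemma lsem_repr_pi A T w : lsem (repr (\pi_ltype A)%qT) T w <-> lsem A T w.
Proof.
apply: psem_sim.1.
have /eqmodP/asboolP // : (\pi_ltype (repr (\pi_ltype A)) = \pi_ltype A)%qT.
by rewrite reprK.
Qed.

Lemma isem_leq s T w w' : w <= w' -> isem s T w -> isem s T w'.
Proof. exact: psem_leq. Qed.

Lemma isem_lin A T w : isem (lin A) T w <-> lsem (repr A) T w.
Proof. exact: isem_pi. Qed.

Lemma isem_arr s A T w : isem (lin (arr s A)) T w <->
  forall N v, isem s N v -> isem (lin A) (App T N) (w + v + 2).
Proof.
rewrite isem_lin lsem_repr_pi /=.
by split=> h N v /h; rewrite isem_lin.
Qed.

Lemma isem_inter ss T w : 1 < size ss ->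
  isem (inter ss) T w <-> forall s, s \in ss -> isem s T (w %/ r).
Proof.
case: ss => [|s1 [|s2 ss]] // _; rewrite isem_pi /=.
have -> : foldr (fun s => and (psem s T (w %/ r))) True [seq repr i | i <- ss]
    <-> forall s, s \in ss -> isem s T (w %/ r).
  elim: ss => //= s ss ->; split=> [[h1 h2] t|h].
    by rewrite inE => /orP[/eqP->|/h2].
  by split=> [|t tss]; apply: h; rewrite inE ?eqxx ?tss ?orbT.
split=> [[h1 [h2 h]] s|h].
  by rewrite !inE => /or3P[/eqP->|/eqP->|/h].
by split; [|split=> [|s sss]]; apply: h; rewrite !inE ?eqxx ?sss ?orbT.
Qed.

End Semantics.

(** * Soundness of the weights *)

Lemma mem_domf (G : ctx) (x : nat) : (x \in domf G) = isSome G.[? x]%fmap.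
Proof. by rewrite fndSome. Qed.

Lemma fnd_ctx1 (x : nat) s (y : nat) :
  (ctx1 x s).[? y]%fmap = if y == x then Some s else None.
Proof. by rewrite fnd_set fnd_fmap0. Qed.

Lemma mem_ctx1 (x : nat) s (y : nat) : (y \in domf (ctx1 x s)) = (y == x).
Proof. by rewrite mem_domf fnd_ctx1; case: eqP. Qed.

Lemma fnd_ctx_zip (xs : seq nat) ss (y : nat) : size xs = size ss -> y \in xs ->
  exists2 s, s \in ss & (ctx_zip xs ss).[? y]%fmap = Some s.
Proof.
elim: xs ss => [|x xs IH] [|s ss] //= [eq_sz]; rewrite inE fnd_set /=.
case: eqP => [_ _|_ /= /(IH _ eq_sz)[t tss yt]].
  by exists s; rewrite ?mem_head.
by exists t; rewrite // inE tss orbT.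
Qed.

Lemma mem_ctx_zip (xs : seq nat) ss (y : nat) :
  y \in domf (ctx_zip xs ss) -> y \in xs.
Proof.
rewrite mem_domf; elim: xs ss => [|x xs IH] [|s ss] //=; try by rewrite fnd_fmap0.
by rewrite fnd_set inE; case: eqP => //= _ /IH.
Qed.

(** As every context declares [x], no component is skipped, and the intersection has as many
    components as there are contexts. *)
Lemma fnd_ctx_inter (Gs : seq ctx) (x : nat) :
    (forall G, G \in Gs -> x \in domf G) -> 0 < size Gs ->
  exists2 ss, (ctx_inter Gs).[? x]%fmap = Some (inter ss) &
    size ss = size Gs /\
    forall G s, G \in Gs -> G.[? x]%fmap = Some s -> s \in ss.
Proof.
move=> xGs Gs0.
have xI : x \in ctx_inter Gs.
  case: Gs Gs0 xGs => // G Gs _ xGs; apply/bigfcupP; exists G.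
    by rewrite mem_head.
  by apply: xGs; rewrite mem_head.
exists (pmap (fun G : ctx => G.[? x]%fmap) Gs).
  by rewrite (in_fnd xI) ffunE.
split=> [|G s GGs Gx]; last by rewrite mem_pmap; apply/mapP; exists G.
rewrite size_pmap; apply/eqP; rewrite -all_count; apply/allP => G /xGs.
by rewrite mem_domf.
Qed.

Lemma deriv_occ G M s (x : nat) : deriv G M s -> occ x M -> x \in domf G.
Proof.
move=> P; elim: P x => {G M s}.
- by move=> x A y /eqP<-; rewrite (mem_ctx1 _ (lin A)).
- by move=> G M s x A _ _ IH y /IH; rewrite mem_catf => ->.
- by move=> G M s A _ IH x /IH; rewrite mem_domf ctx_pushS -mem_domf.
- move=> G D M N s A _ _ IHM _ IHN x; rewrite mem_catf.
  by case/orP => [/IHM->|/IHN->]; rewrite ?orbT.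
- move=> n Gs M ss n1 _ IH x /(IH (Ordinal (ltnW n1))) xG.
  by apply/bigfcupP; exists (tnth Gs (Ordinal (ltnW n1))); rewrite ?mem_tnth.
- move=> n G x xs ss M t _ _ _ _ _ IH z /occ_rename[y /IH].
  rewrite !mem_catf mem_ctx1 => /orP[yG|/mem_ctx_zip ->].
    by case: ifP => _ <-; rewrite ?eqxx ?yG ?orbT.
  by move=> <-; rewrite eqxx orbT.
Qed.

(** * Weights of free variables and the induction on derivations *)

Definition fvsum (K : nat) (M : term) (v : nat -> nat) : nat :=
  \sum_(x < K) occ x M * v x.

Lemma fvsum_Lam K M v :
  fvsum K.+1 M v = occ 0 M * v 0 + fvsum K (Lam M) (v \o succn).
Proof. exact: big_ord_recl. Qed.

Lemma fvsum_Var K x v : x < K -> fvsum K (Var x) v = v x.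
Proof.
move=> xK; rewrite /fvsum (bigD1 (Ordinal xK)) //= eqxx mul1n big1 ?addn0 //.
by move=> i /eqP/eqP; rewrite -val_eqE /= eq_sym => /negbTE->.
Qed.

Lemma fvsum_widen K K' M v : K <= K' -> (forall x, occ x M -> x < K) ->
  fvsum K' M v = fvsum K M v.
Proof.
move=> KK' MK; rewrite /fvsum -!(big_mkord xpredT (fun x => occ x M * v x)).
rewrite (big_cat_nat (n := K)) //= [X in _ + X]big_nat [X in _ + X]big1 ?addn0 //.
by move=> x /andP[Kx _]; case: (boolP (occ x M)) => // /MK; rewrite ltnNge Kx.
Qed.

Lemma fvsum1_size K M : fvsum K M (fun=> 1) <= term_size M.
Proof.
elim: M K => [x|M IHM N IHN|M IHM] K /=.
- have [xK|Kx] := ltnP x K; first by rewrite fvsum_Var.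
  rewrite /fvsum big1 // => i _ /=; case: eqP => // xi.
  by move: (ltn_ord i); rewrite -xi ltnNge Kx.
- apply: leq_trans (leq_trans (leq_add (IHM K) (IHN K)) (leq_addr _ _)).
  rewrite /fvsum -big_split leq_sum //= => i _.
  by case: occ; case: occ.
- by move: (IHM K.+1); rewrite fvsum_Lam /fvsum /=; lia.
Qed.

Lemma occ_merge_vars x xs M y : occ y M ->
  occ (if y \in xs then x else y) (merge_vars x xs M).
Proof. by move=> yM; apply/occ_rename; exists y. Qed.

(** At most [term_size M <= r] merged variables occur, each with weight [v x %/ r], so together they
    weigh at most [v x]. The condition [y != x] keeps [x] from being counted a second time. *)
Lemma fvsum_merge_vars r K x xs M v : term_size M <= r ->
    (forall y, occ y M -> y \notin xs -> y != x) ->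
    (occ x (merge_vars x xs M) -> x < K) ->
  fvsum K M (fun y => if y \in xs then v x %/ r else v y) <=
  fvsum K (merge_vars x xs M) v.
Proof.
move=> Mr Mx xK; have [xM|xM] := boolP (occ x (merge_vars x xs M)); last first.
  apply: leq_sum => y _; have [yM|_] := boolP (occ y M); last by rewrite mul0n.
  have := occ_merge_vars x xs yM; case: ifP => [_|_ ->] //.
  by rewrite (negbTE xM).
rewrite /fvsum (bigID (fun y : 'I_K => val y \in xs)) /=.
rewrite [leqRHS](bigD1 (Ordinal (xK xM))) //= xM mul1n leq_add //.
- apply: leq_trans (leq_divM (v x) r).
  apply: (@leq_trans ((v x %/ r) * fvsum K M (fun=> 1))); last first.
    by rewrite leq_mul2l (leq_trans (fvsum1_size _ _) Mr) orbT.
  rewrite /fvsum big_distrr big_mkcond leq_sum //= => y _.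
  by case: ifP => // ->; rewrite muln1 mulnC.
- rewrite big_mkcond [leqRHS]big_mkcond leq_sum //= => y _.
  have [//|yxs] := boolP (val y \in xs); rewrite -val_eqE /=.
  have [yM|_] := boolP (occ y M); last by rewrite mul0n.
  rewrite (Mx _ yM yxs); have := occ_merge_vars x xs yM.
  by rewrite (negbTE yxs) => ->.
Qed.

(** Only occurring variables are constrained and weighed, so weakened variables are free and a
    multiplexor of any arity merges at most [r] weighed ones. *)
Lemma fundamental r G M s (P : deriv G M s) K th v :
    term_size M <= r -> (forall x, occ x M -> x < K) ->
    (forall x t, occ x M -> G.[? x]%fmap = Some t -> isem r t (th x) (v x)) ->
  isem r s (subst th M) (cost M * r ^ degree P + fvsum K M v).
Proof.
elim: P K th v => {G M s}.
- move=> x A K th v _ xK thv.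
  have xx : occ x (Var x) by apply: eqxx.
  by rewrite fvsum_Var ?xK //; apply: thv; rewrite // fnd_ctx1 eqxx.
- move=> G M s x A xG P IH K th v Mr MK thv; apply: IH => // y t yM yt.
  apply: thv => //; rewrite fnd_cat mem_ctx1; case: eqP => // yx.
  by rewrite mem_domf -yx yt in xG.
- move=> G M s A P IH K th v Mr MK thv; apply/isem_arr => N u Nu.
  rewrite /= in Mr; have r0 : 0 < r by lia.
  have {IH} := IH K.+1 (scons N th) (fun x => if x is y.+1 then v y else u).
  rewrite -inst_up_subst fvsum_Lam => /(_ _ _ _)/isem_lin H.
  have rd : 0 < r ^ degree P by rewrite expn_gt0 r0.
  set w := (w in lsem _ _ _ w) in H; apply/isem_lin.
  have {}H : lsem r (repr A) (inst (subst (up_subst th) M) N) w.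
    apply: H => [|[|x] //= /MK|[|x] t xM] //; first by lia.
      by rewrite ctx_push0 => -[<-].
    by rewrite ctx_pushS; apply: thv.
  have Ew : w = cost M * r ^ degree P + (occ 0 M * u + fvsum K (Lam M) v) by [].
  (* If the bound variable occurs, the sum already contains [u]; otherwise the dropped argument
     brings it in. The expansion cost 3 is covered by the application's 2 and the abstraction's
     [r ^ degree P >= 1]. *)
  rewrite {}Ew in H; have [M0|M0] := boolP (occ 0 M).
    have E : head_exp 3 (App (Lam (subst (up_subst th) M)) N)
                      (inst (subst (up_subst th) M) N).
      by apply: head_exp_occ; rewrite occ0_up_subst.
    by apply: lsem_leq (lsem_head_exp E H); rewrite M0 /=; lia.
  have E : head_exp (u + 3) (App (Lam (subst (up_subst th) M)) N)
                      (inst (subst (up_subst th) M) N).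
    apply: head_exp_drop; first by rewrite occ0_up_subst.
    exact: psem_bounded Nu.
  by apply: lsem_leq (lsem_head_exp E H); rewrite (negbTE M0) /=; lia.
- move=> G D M N s A GD P IHM Q IHN K th v Mr MK thv; rewrite /= in Mr.
  have GND x : occ x M -> x \notin domf D.
    by move/(deriv_occ P); apply/fdisjointP.
  have H1 := IHM K th v _ _ _; have H2 := IHN K th v _ _ _.
  have /isem_arr {H1}H1 : isem r (lin (arr s A)) (subst th M)
      (cost M * r ^ degree P + fvsum K M v).
    apply: H1 => [|x xM|x t xM xt]; first by lia.
      by apply: MK; rewrite /= xM.
    by apply: thv; [rewrite /= xM | rewrite fnd_cat (negbTE (GND _ xM))].
  have {}/H1 : isem r s (subst th N) (cost N * r ^ degree Q + fvsum K N v).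
    apply: H2 => [|x xM|x t xM xt]; first by lia.
      by apply: MK; rewrite /= xM orbT.
    by apply: thv; [rewrite /= xM orbT | rewrite fnd_cat (deriv_occ Q)].
  apply: isem_leq.
  (* Disjoint contexts mean that [M] and [N] share no free variable, so the sums add exactly. *)
  have -> : fvsum K (App M N) v = fvsum K M v + fvsum K N v.
    rewrite /fvsum -big_split; apply: eq_bigr => x _ /=.
    have [/GND xD|_] := boolP (occ x M); last by rewrite mul0n.
    have [/(deriv_occ Q)|_] := boolP (occ x N); first by rewrite (negbTE xD).
    by rewrite mul0n addn0.
  have r0 : 0 < r by lia.
  rewrite [degree (d_arrE _ _ _)]/= [cost (App _ _)]/=; set d := maxn _ _.
  have le1 : r ^ degree P <= r ^ d by rewrite leq_pexp2l // leq_maxl.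
  have le2 : r ^ degree Q <= r ^ d by rewrite leq_pexp2l // leq_maxr.
  have rd : 0 < r ^ d by rewrite expn_gt0 r0.
  move: (leq_mul (leqnn (cost M)) le1) (leq_mul (leqnn (cost N)) le2); lia.
- move=> n Gs M ss n1 P IH K th v Mr MK thv.
  have r0 : 0 < r by case: (M) Mr => /=; lia.
  apply/isem_inter; rewrite ?size_tuple // => _ /tnthP[i ->].
  (* Each premise uses one component of every variable's intersection, hence the weights divided by
     [r]; multiplying back by [r] raises the degree by one. *)
  have H := IH i K th (fun x => v x %/ r) Mr MK.
  have {}/H : forall x t, occ x M -> (tnth Gs i).[? x]%fmap = Some t ->
      isem r t (th x) (v x %/ r).
    move=> x t xM xt.
    have [G /tnthP[j ->]||us xus [sz us_all]] := @fnd_ctx_inter Gs x.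
    + exact: deriv_occ (P j) xM.
    + by rewrite size_tuple ltnW.
    + have /isem_inter := thv _ _ xM xus; apply; first by rewrite sz size_tuple.
      by apply: us_all xt; exact: mem_tnth.
  apply: isem_leq; rewrite leq_divRL // mulnDl leq_add //.
  + rewrite -mulnA leq_mul2l -expnSr leq_pexp2l ?orbT // ltnS.
    exact: (leq_bigmax (F := fun i => degree (P i))).
  + rewrite /fvsum big_distrl leq_sum //= => x _.
    by rewrite -mulnA leq_mul2l leq_divM orbT.
- move=> n G x xs ss M t n1 xs_uniq xsG xG P IH K th v Mr MK thv.
  set M1 := merge_vars x xs M in Mr MK thv *.
  have ren_occ y : occ y M -> occ (if y \in tval xs then x else y) M1.
    exact: occ_merge_vars.
  have Mx y : occ y M -> y \notin tval xs -> y != x.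
    move=> yM yxs; have := deriv_occ P yM; rewrite mem_catf => /orP[yG|].
      by apply: contraNneq xG => <-.
    by move/mem_ctx_zip; rewrite (negbTE yxs).
  (* The merged names of the premise may lie beyond [K]. *)
  pose K1 := maxn K (\max_(y <- xs) y).+1.
  rewrite -(@fvsum_widen K K1) ?leq_maxl //.
  have {}Mr : term_size M <= r by move: Mr; rewrite !term_sizeE cost_rename.
  have le : fvsum K1 M (fun y => if y \in tval xs then v x %/ r else v y) <=
            fvsum K1 M1 v.
    by apply: fvsum_merge_vars => // /MK xK; rewrite leq_max xK.
  rewrite {1 2}/M1 /merge_vars subst_rename cost_rename.
  apply: isem_leq;
    last apply: (IH K1 _ (fun y => if y \in tval xs then v x %/ r else v y)).
  + by rewrite leq_add2l.
  + by [].
  + move=> y /ren_occ; case: ifP => [yxs _|_ /MK yK]; rewrite leq_max ?yK //.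
    by rewrite ltnS (@leq_bigmax_seq _ _ xpredT id) ?orbT.
  + move=> y t' yM; have := ren_occ _ yM; rewrite fnd_cat mem_domf /=.
    case: ifP => [yxs xM|/negbT yxs yM1].
      have [|s s_ss ->] := @fnd_ctx_zip xs ss y _ yxs.
        by rewrite !size_tuple.
      move=> [<-]; have : isem r (inter ss) (th x) (v x).
        by apply: thv; rewrite // fnd_cat mem_ctx1 eqxx fnd_ctx1 eqxx.
      by move/isem_inter; apply; rewrite ?size_tuple.
    case: ifP => [|_ yt].
      by rewrite -mem_domf => /mem_ctx_zip; rewrite (negbTE yxs).
    by apply: thv => //; rewrite fnd_cat mem_ctx1 (negbTE (Mx _ yM yxs)).
Qed.

Theorem mainTheorem1 (G : ctx) (M : term) (s : itype) (P : deriv G M s)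
    (n : nat) (M' : term) (red : beta_steps n M M') :
  n < term_size M ^ (degree P + 1) /\
  (0 < n -> term_size M' < term_size M ^ (degree P + 1)).
Proof.
have [K MK] : exists K, forall x, occ x M -> x < K.
  exists (\max_(x <- domf G) x).+1 => x /(deriv_occ P) xG.
  exact: (@leq_bigmax_seq _ _ xpredT id).
(* The identity substitution is used: variables have weight 0 at every type, so the sum vanishes. *)
have := fundamental P (leqnn _) MK (fun x t _ _ => psem_Var _ (repr t) x).
rewrite subst_Var /fvsum big1 ?addn0 => [|x _]; last by rewrite muln0.
move/psem_bounded/bounded_beta_steps => /(_ _ _ red).
(* With [r = cost M + 1], [r ^ (d + 1)] is [r ^ d + cost M * r ^ d], hence exceeds [n + cost M'].
   For (ii), [0 < n] absorbs the one in [term_size M' = cost M' + 1]. *)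
rewrite addn1 expnS term_sizeE (term_sizeE M') [in _.+1 * _]mulSn.
have : 0 < (cost M).+1 ^ degree P by rewrite expn_gt0.
lia.
Qed.
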